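(* Let $(X,T)$ be a $\frac{\mathbb Z\text{-sofic}}{\text{subshift}}$ dynamical system. If $X$ is infinite, then some point of $X$ has an infinite $T$-orbit.
   Context: A $\mathbb Z$-subshift is a closed shift-invariant subset of $\Sigma^{\mathbb Z}$, $\Sigma$ a finite alphabet; it is an SFT if defined by finitely many forbidden words, and sofic if it is the image of an SFT under a continuous shift-commuting map. $(\Sigma^2)^{\mathbb Z}$ is identified with $\Sigma^{\mathbb Z}\times\Sigma^{\mathbb Z}$. A dynamical $\mathbb Z$-system $(X,T)$ ($T$ a homeomorphism of a compact metrizable space $X$) is $\frac{\mathbb Z\text{-sofic}}{\text{subshift}}$ if it is conjugate (equivariantly homeomorphic) to $Y/Z$ for some sofic shift $Y\subset\Sigma^{\mathbb Z}$ and some subshift $Z\subset(\Sigma^2)^{\mathbb Z}$ such that $Z\cap Y^2$ is an equivalence relation on $Y$, where $Y/Z$ is the topological quotient $Y/(Z\cap Y^2)$ with the homeomorphism induced by the shift. *)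

(* Defs.v *)
From HB Require Import structures.
From mathcomp Require Import all_boot all_order all_algebra generic_quotient.
From mathcomp Require Import boolp classical_sets functions cardinality reals.
From mathcomp Require Import topology metric_structure.

Set Implicit Arguments.
Unset Strict Implicit.
Unset Printing Implicit Defensive.

Import GRing.Theory.

Local Open Scope classical_set_scope.
Local Open Scope ring_scope.
Local Open Scope quotient_scope.

Definition homeomorphism (X Y : topologicalType) (f : X -> Y) : Prop :=
  continuous f /\
  exists g : Y -> X, [/\ continuous g, cancel f g & cancel g f].

Definition metrizable (R : realType) (X : topologicalType) : Prop :=
  exists (M : metricType R) (h : X -> M), homeomorphism h.

Definition Zsystem (R : realType) (X : topologicalType) (T : X -> X) : Prop :=
  [/\ compact [set: X], metrizable R X & homeomorphism T].

Definition conjugate (X Y : topologicalType) (T : X -> X) (S : Y -> Y) : Prop :=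
  exists h : X -> Y, homeomorphism h /\ forall x, h (T x) = S (h x).

(* The two-sided orbit {T^n x : n in Z} of a bijection T; the second disjunct
   is y = T^(-n) x. *)
Definition Zorbit (X : Type) (T : X -> X) (x : X) : set X :=
  [set y | exists n : nat, iter n T x = y \/ iter n T y = x].

Definition full_shift (A : finType) : topologicalType :=
  prod_topology (fun _ : int => discrete_topology A).

Definition shift (A : finType) (x : full_shift A) : full_shift A :=
  fun i : int => x (i + 1).

(* Invariance is under the Z-action, hence an equality. *)
Record subshift (A : finType) := Subshift {
  subshift_set :> set (full_shift A);
  subshift_closed : closed subshift_set;
  subshift_invariant : @shift A @` subshift_set = subshift_set
}.

Lemma subshift_shift (A : finType) (Y : subshift A) (y : Y) :
  shift (set_val y) \in (Y : set (full_shift A)).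
Proof.
by rewrite inE -[X in X (shift _)]subshift_invariant; exists (set_val y) => //; apply: set_valP.
Qed.

Definition subshift_map (A : finType) (Y : subshift A) (y : Y) : Y :=
  exist _ (shift (set_val y)) (subshift_shift y).

Definition subword (A : finType) (x : full_shift A) (i : int) (n : nat) : seq A :=
  mkseq (fun k : nat => x (i + k%:Z)) n.

Definition SFT (A : finType) (S : subshift A) : Prop :=
  exists F : seq (seq A),
    (S : set (full_shift A)) =
    [set x | forall w, w \in F -> forall i, subword x i (size w) <> w].

Definition sofic (A : finType) (Y : subshift A) : Prop :=
  exists (B : finType) (S : subshift B) (f : S -> full_shift A),
    [/\ SFT S, continuous f,
        forall x : S, f (subshift_map x) = shift (f x)
      & range f = Y].

(* The identification of A^Z x A^Z with (A^2)^Z. *)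
Definition zip_config (A : finType) (x y : full_shift A) :
  full_shift (A * A)%type := fun i : int => (x i, y i).

Section quotient_shift.
Variables (A : finType) (Y : subshift A) (e : equiv_rel Y).

Definition quotient_space : topologicalType :=
  quotient_topology {eq_quot e}.

(* Independent of the representative when e is shift-invariant, see
   quotient_shiftE. *)
Definition quotient_shift (q : quotient_space) : quotient_space :=
  \pi_{eq_quot e} (subshift_map (repr (q : {eq_quot e}))).

Lemma quotient_shiftE (Z : subshift (A * A)%type) :
  (forall x y : Y, e x y <-> subshift_set Z (zip_config (set_val x) (set_val y))) ->
  forall y : Y, quotient_shift (\pi_{eq_quot e} y)
    = \pi_{eq_quot e} (subshift_map y).
Proof.
move=> eZ y; rewrite /quotient_shift; apply/eqmodP/eZ.
have /eqmodP/eZ Zy : repr (\pi_{eq_quot e} y) = y %[mod {eq_quot e}].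
  by rewrite reprK.
by rewrite -[X in X _]subshift_invariant; eexists; first exact: Zy.
Qed.

End quotient_shift.

(* Asking for an equiv_rel with graph Z on Y is asking that the intersection of
   Z and Y^2 be an equivalence relation on Y. *)
Definition sofic_over_subshift (X : topologicalType) (T : X -> X) : Prop :=
  exists (A : finType) (Y : subshift A) (Z : subshift (A * A)%type)
         (e : equiv_rel Y),
    [/\ sofic Y,
        forall x y : Y, e x y <-> subshift_set Z (zip_config (set_val x) (set_val y))
      & conjugate T (@quotient_shift A Y e)].

(* Main.v *)
Require Import Defs.
From mathcomp Require Import all_boot all_order all_algebra.
From mathcomp Require Import boolp classical_sets functions cardinality reals.
From mathcomp Require Import topology.
From mathcomp Require Import filter generic_quotient zify.

Local Open Scope classical_set_scope.

(** Write the sofic shift [Y] as the image of an SFT [S] under a continuous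
shift-commuting map [f], let [N] bound the lengths of the forbidden words of
[S], and call [x] and [y] in [S] related when the pair [(f x, f y)] lies in
[Z]. Assume that every orbit of the quotient is finite, so that every [x] in
[S] is related to one of its shifts by some [p > 0]. It suffices to show that
two points [s], [s'] of [S] which agree on the window [0, N) are related: the
quotient then has at most as many points as there are words of length [N],
so it is finite.

Let [u] be the configuration equal to [s] on the negative half-line and to
[s'] on the other one; no forbidden word is long enough to see the junction,
so [u] lies in [S] ([splice_SFT]). Now [u] is right-asymptotic to [s'], and
both points are related to all their shifts by multiples of some common
[m > 0]. Along an ultrafilter, the shifts of [s'] and of [u] by [m * n]
converge to one and the same [t] in [S]; as [Z] is closed, [s'] and [u] are
both related to [t] ([asymptotic_common_limit]). Shifting in the other
direction relates [s] and [u] in the same way, so [s] and [s'] are related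
([same_window_related]). *)

Set Implicit Arguments.
Unset Strict Implicit.

Section SplicingArgument.
Import Order.TTheory GRing.Theory Num.Theory.
Local Open Scope ring_scope.

(** * Convergence of configurations *)

Lemma cvg_initial (S : choiceType) (T : topologicalType) (f : S -> T)
    (F : set_system S) (s : S) : Filter F ->
  f @ F --> f s -> F --> (s : initial_topology f).
Proof.
move=> FF Ffs U /=; rewrite (@nbhsE (initial_topology f)) => -[B [[C oC CB] Bs] BU].
apply: (filterS BU); rewrite -CB; apply: Ffs; apply: open_nbhs_nbhs.
by split=> //; move: Bs; rewrite -CB.
Qed.

(** Letters being discrete, convergence of configurations means that each
coordinate is eventually equal to that of the limit. *)
Lemma cvg_full_shift (A : finType) (F : set_system (full_shift A))
    (t : full_shift A) : Filter F ->
  F --> t <-> forall i, F [set x | x i = t i].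
Proof.
move=> FF; split=> [Ft i|Ft].
  move/cvg_sup: Ft => /(_ i) Fti.
  apply: (Fti [set x | x i = t i]).
  exact: (@initial_continuous _ _ (fun x : full_shift A => x i) t _ (discrete_set1 _)).
apply/cvg_sup => i; apply: cvg_initial => U Ui.
have sub : [set x : full_shift A | x i = t i] `<=` (fun x => x i) @^-1` U.
  by move=> x /= ->; exact: nbhs_singleton Ui.
exact: filterS sub (Ft i).
Qed.

Lemma cvg_subshift (A : finType) (S : subshift A) (F : set_system S) (t : S) :
  Filter F -> (forall i, F [set x | set_val x i = set_val t i]) -> F --> t.
Proof.
move=> FF Ft; apply: cvg_initial; apply/cvg_full_shift; exact: Ft.
Qed.

Lemma ultra_fin_value (T : Type) (A : finType) (F : set_system T) (v : T -> A) :
  UltraFilter F -> exists a, F [set x | v x = a].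
Proof.
move=> FU; apply: contrapT => noa.
have: \forall x \near F, forall a, v x <> a.
  apply: filter_forall => a.
  case: (in_ultra_setVsetC [set x | v x = a] FU) => // Fa.
  by case: noa; exists a.
by move=> /filter_ex [x /(_ (v x))].
Qed.

(** * Integer powers of the shift *)

(** The [k]-th power of the shift, for [k] of any sign. *)
Definition shiftz (A : finType) (k : int) (x : full_shift A) : full_shift A :=
  fun i => x (i + k).

Lemma shiftzD (A : finType) (k l : int) (x : full_shift A) :
  shiftz k (shiftz l x) = shiftz (k + l) x.
Proof. by apply/funext => i; rewrite /shiftz addrA. Qed.

Lemma shiftz0 (A : finType) (x : full_shift A) : shiftz 0 x = x.
Proof. by apply/funext => i; rewrite /shiftz addr0. Qed.

Lemma shift_subshift (A : finType) (S : subshift A) (x : full_shift A) :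
  subshift_set S (shiftz 1 x) <-> subshift_set S x.
Proof.
rewrite -[X in X (shiftz _ _)]subshift_invariant; split=> [[y Sy yx]|Sx].
  suff -> : x = y by [].
  apply/funext => i; have := congr1 (fun z => z (i - 1)) yx.
  by rewrite /shift /shiftz subrK => ->.
by exists x.
Qed.

Lemma shiftz_subshift (A : finType) (S : subshift A) (k : int)
    (x : full_shift A) :
  subshift_set S (shiftz k x) <-> subshift_set S x.
Proof.
have natE (n : nat) y : subshift_set S (shiftz n%:Z y) <-> subshift_set S y.
  elim: n => [|n IH]; first by rewrite shiftz0.
  by rewrite intS -shiftzD shift_subshift.
case: (intP k) => [|n|n]; first by rewrite shiftz0.
  exact: natE.
by rewrite -(natE n.+1) shiftzD subrr shiftz0.
Qed.

Lemma zip_shiftz (A : finType) (Z : subshift (A * A)%type) (k : int)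
    (x y : full_shift A) :
  subshift_set Z (zip_config (shiftz k x) (shiftz k y)) <->
  subshift_set Z (zip_config x y).
Proof. exact: (shiftz_subshift Z k (zip_config x y)). Qed.

(** The [k]-th power of the shift, restricted to a subshift. *)
Definition subshiftz (A : finType) (S : subshift A) (k : int) (x : S) : S :=
  exist _ (shiftz k (set_val x))
    (mem_set ((shiftz_subshift S k (set_val x)).2 (set_valP x))).

Lemma equivariantz (A B : finType) (S : subshift B) (f : S -> full_shift A) :
    (forall x : S, f (subshift_map x) = shift (f x)) ->
  forall k x, f (subshiftz k x) = shiftz k (f x).
Proof.
move=> fS.
have f1 x : f (subshiftz 1 x) = shiftz 1 (f x).
  rewrite -[RHS]fS; congr f; exact: val_inj.
have fn (n : nat) x : f (subshiftz n%:Z x) = shiftz n%:Z (f x).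
  elim: n => [|n IH]; first by rewrite shiftz0; congr f; apply: val_inj; exact: shiftz0.
  rewrite intS -shiftzD -IH -f1; congr f; apply: val_inj => /=.
  by rewrite !set_valE /= shiftzD.
move=> k x; case: (intP k) => [|n|n]; [exact: fn|exact: fn|].
have {2}-> : x = subshiftz n.+1%:Z (subshiftz (- n.+1%:Z) x).
  by apply: val_inj => /=; rewrite !set_valE /= shiftzD subrr shiftz0.
by rewrite fn shiftzD addNr shiftz0.
Qed.

(** * Asymptotic points *)

(** If the shifts of [s] and [u] by [k n] become equal on every coordinate, they
have a common limit along any ultrafilter finer than the filter at infinity,
and the closed relation [Z] passes to that limit. *)
Lemma asymptotic_common_limit (A B : finType) (S : subshift B)
    (f : S -> full_shift A) (Z : subshift (A * A)%type) (k : nat -> int) (s u : S) :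
    continuous f ->
    (forall x : S, f (subshift_map x) = shift (f x)) ->
    (forall i, \forall n \near \oo, set_val s (i + k n) = set_val u (i + k n)) ->
    (forall n, subshift_set Z (zip_config (f s) (shiftz (k n) (f s)))) ->
    (forall n, subshift_set Z (zip_config (f u) (shiftz (k n) (f u)))) ->
  exists t : S, subshift_set Z (zip_config (f s) (f t)) /\
                subshift_set Z (zip_config (f u) (f t)).
Proof.
move=> fcont fS su sZ uZ.
have [U [UU ooU]] := @ultraFilterLemma nat \oo _.
have /choice[t0 t0P] i : exists b, U [set n | set_val s (i + k n) = b].
  exact: ultra_fin_value.
have St0 : subshift_set S t0.
  apply: (@closed_cvg _ _ U _ (fun n => shiftz (k n) (set_val s))).
  - exact: subshift_closed.
  - by apply: filterE => n; apply/shiftz_subshift; exact: set_valP.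
  - exact/cvg_full_shift.
pose t : S := exist _ t0 (mem_set St0).
have lim (v : S) : (forall i, U [set n | set_val v (i + k n) = t0 i]) ->
    (forall n, subshift_set Z (zip_config (f v) (shiftz (k n) (f v)))) ->
    subshift_set Z (zip_config (f v) (f t)).
  move=> vt vZ.
  have vT : (fun n => subshiftz (k n) v) @ U --> t by exact: cvg_subshift.
  have /cvg_full_shift fT : (fun n => f (subshiftz (k n) v)) @ U --> f t.
    exact: cvg_comp vT (fcont t).
  apply: (@closed_cvg _ _ U _ (fun n => zip_config (f v) (shiftz (k n) (f v)))).
  - exact: subshift_closed.
  - exact: filterE.
  - apply/cvg_full_shift => i.
    have sub : [set n | f (subshiftz (k n) v) i = f t i] `<=`
        [set n | zip_config (f v) (shiftz (k n) (f v)) i = zip_config (f v) (f t) i].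
      by move=> n /=; rewrite equivariantz // /zip_config => ->.
    exact: filterS sub (fT i).
exists t; split; apply: lim => // i.
apply: (@filterS2 _ U _ _ _ _ _ (t0P i) (ooU _ (su i))).
by move=> n /= <- ->.
Qed.

(** * Splicing in a shift of finite type *)

(** The configuration equal to [x] at negative positions and to [y] elsewhere. *)
Definition splice (B : finType) (x y : full_shift B) : full_shift B :=
  fun i => if i < 0 then x i else y i.

(** An occurrence of a word of length at most [N] that starts at a negative
position ends before [N], hence sees only letters of [x], since [x] and [y]
agree on [0, N); any other one sees only letters of [y]. *)
Lemma splice_SFT (B : finType) (F : seq (seq B)) (N : nat) (x y : full_shift B) :
    (forall w, w \in F -> (size w <= N)%N) ->
    (forall i : nat, (i < N)%N -> x i%:Z = y i%:Z) ->
    (forall w, w \in F -> forall i, subword x i (size w) <> w) ->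
    (forall w, w \in F -> forall i, subword y i (size w) <> w) ->
  forall w, w \in F -> forall i, subword (splice x y) i (size w) <> w.
Proof.
move=> FN xy Fx Fy w wF i; have wN := FN _ wF.
case: (ltP i 0) => i0.
  suff -> : subword (splice x y) i (size w) = subword x i (size w) by exact: Fx.
  apply/eq_in_map => j; rewrite mem_iota add0n /= => jw; rewrite /splice.
  case: ifPn => // ij.
  rewrite -leNgt in ij; rewrite -(gez0_abs ij) xy //.
  rewrite -ltz_nat gez0_abs //; apply: lt_le_trans (_ : (size w)%:Z <= N%:Z) => //.
  by rewrite -[ltRHS]add0r ltr_leD // ltW.
suff -> : subword (splice x y) i (size w) = subword y i (size w) by exact: Fy.
apply/eq_in_map => j _; rewrite /splice; case: ifPn => // ij.
by exfalso; lia.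
Qed.

(** * Finiteness *)

Lemma finite_orbit_periodic (X : Type) (T : X -> X) (x : X) :
  injective T -> finite_set (Zorbit T x) ->
  exists2 p : nat, (0 < p)%N & iter p T x = x.
Proof.
move=> Tinj fin.
have iterI n : injective (iter n T).
  by elim: n => // n IH y z /= /Tinj /IH.
apply: contrapT => nop; apply: infinite_nat.
have -> : [set: nat] = (fun n => iter n T x) @^-1` Zorbit T x.
  by apply/seteqP; split=> // n _; exists n; left.
apply: finite_preimage fin.
suff H m n : (m < n)%N -> iter m T x <> iter n T x.
  move=> m n _ _ E; case: (ltngtP m n) => // lt; exfalso.
    exact: (H _ _ lt).
  exact: (H _ _ lt).
move=> mn E; apply: nop; exists (n - m)%N; first by rewrite subn_gt0.
by apply: (iterI m); rewrite -iterD subnKC // ltnW.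
Qed.

(** A type is finite if each of its points is related to some element of a
finite type, and distinct points never to the same one. *)
Lemma finite_of_fin_invariant (X : Type) (W : finType) (r : X -> W -> Prop) :
  (forall x, exists w, r x w) -> (forall x y w, r x w -> r y w -> x = y) ->
  finite_set [set: X].
Proof.
move=> /choice [g gP] rI.
have -> : [set: X] = g @^-1` [set: W] by [].
apply: finite_preimage; last exact: finite_finset.
by move=> x y _ _ gxy; apply: (rI x y (g x)) => //; rewrite gxy.
Qed.

(** Pulling [Z] back along [f] gives a closed shift-invariant relation on the
SFT [S]. If it is an equivalence all of whose classes are periodic, then its
classes are determined by the letters read in the window [0, N). *)
Lemma same_window_related (A B : finType) (S : subshift B)
    (f : S -> full_shift A) (Z : subshift (A * A)%type)
    (F : seq (seq B)) (N : nat) (s s' : S) :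
    continuous f ->
    (forall x : S, f (subshift_map x) = shift (f x)) ->
    (forall x, subshift_set Z (zip_config (f x) (f x))) ->
    (forall x y, subshift_set Z (zip_config (f x) (f y)) ->
      subshift_set Z (zip_config (f y) (f x))) ->
    (forall x y z, subshift_set Z (zip_config (f x) (f y)) ->
      subshift_set Z (zip_config (f y) (f z)) ->
      subshift_set Z (zip_config (f x) (f z))) ->
    (forall x, exists2 p : nat, (0 < p)%N &
      subshift_set Z (zip_config (f x) (shiftz p%:Z (f x)))) ->
    (forall x, subshift_set S x <->
      forall w, w \in F -> forall i, subword x i (size w) <> w) ->
    (forall w, w \in F -> (size w <= N)%N) ->
    (forall i : nat, (i < N)%N -> set_val s i%:Z = set_val s' i%:Z) ->
  subshift_set Z (zip_config (f s) (f s')).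
Proof.
move=> fcont fS eR eS eT per SF FN ss'.
have perz x : exists2 p : nat, (0 < p)%N &
    forall k : int, subshift_set Z (zip_config (f x) (shiftz (p%:Z * k) (f x))).
  have [p p0 pP] := per x; exists p => //.
  have natP (n : nat) :
      subshift_set Z (zip_config (f x) (shiftz (p%:Z * n%:Z) (f x))).
    elim: n => [|n IH]; first by rewrite mulr0 shiftz0; exact: eR.
    rewrite intS mulrDr mulr1 -shiftzD -!equivariantz //.
    apply: (eT _ (subshiftz p%:Z x)); rewrite !equivariantz //.
    exact/(zip_shiftz Z p%:Z).
  (* For a negative multiple, shift the relation for the opposite one back
     and use symmetry. *)
  move=> k; case: (intP k) => [|m|m]; [exact: natP 0%N|exact: natP|].
  rewrite -equivariantz //; apply: eS; rewrite equivariantz //.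
  apply/(zip_shiftz Z (p%:Z * m.+1%:Z)).
  by rewrite shiftzD mulrN subrr shiftz0; exact: natP.
have Su : subshift_set S (splice (set_val s) (set_val s')).
  apply/SF; apply: (@splice_SFT _ _ N) => //; apply/SF; exact: set_valP.
pose u : S := exist _ (splice (set_val s) (set_val s')) (mem_set Su).
(* The sign [e = 1] or [e = -1] is the direction in which [v] and [u] are
   asymptotic. *)
have key (v : S) (e : int) :
    (forall i : int, \forall n \near \oo,
      forall m : nat, (n <= m)%N -> set_val v (i + e * m%:Z) = set_val u (i + e * m%:Z)) ->
    subshift_set Z (zip_config (f v) (f u)).
  move=> vu; have [p p0 pP] := perz v; have [q q0 qP] := perz u.
  (* [p * q] is a common period of the classes of [v] and [u]. *)
  have [||i|n|n|t [vt ut]] := @asymptotic_common_limit A B S f Z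
    (fun n => e * (p * q * n)%N%:Z) v u => //.
  - have [n _ /(_ n (leqnn _)) nP] := vu i.
    exists n => // m /= nm; apply: nP.
    by rewrite (leq_trans nm) // leq_pmull // muln_gt0 p0.
  - have -> : e * (p * q * n)%N%:Z = p%:Z * (e * q%:Z * n%:Z) by lia.
    exact: pP.
  - have -> : e * (p * q * n)%N%:Z = q%:Z * (e * p%:Z * n%:Z) by lia.
    exact: qP.
  - exact: eT vt (eS _ _ ut).
apply: (eT _ u).
  apply: (key s (-1)) => // i; exists (absz i).+1 => // n /= ni m nm.
  by rewrite !set_valE /= /splice ifT //; lia.
apply: eS; apply: (key s' 1) => // i; exists (absz i).+1 => // n /= ni m nm.
by rewrite !set_valE /= /splice ifF //; lia.
Qed.

End SplicingArgument.

Unset Implicit Arguments.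

Theorem proposition9p5 (R : realType) (X : topologicalType) (T : X -> X) :
  Zsystem R T -> sofic_over_subshift T -> infinite_set [set: X] ->
  exists x : X, infinite_set (Zorbit T x).
Proof.
move=> [_ _ [_ [T' [_ TK _]]]] [A [Y [Z [e [sofY eZ conj]]]]] infX.
apply: contrapT => /forallNP noinf; apply: infX.
have fin x : finite_set (Zorbit T x) by apply: contrapT; exact: noinf.
have [B [S [f [[F SF] fcont fS fY]]]] := sofY.
have [h [[_ [g [_ hK gK]]] hT]] := conj.
have Yf s : subshift_set Y (f s) by rewrite -fY; exists s.
pose y s : Y := exist _ (f s) (mem_set (Yf s)).
(* The points of the quotient represented by elements of [Y]. *)
pose q (z : Y) : quotient_space e := (\pi_({eq_quot e}) z)%qT.
have qE (z z' : Y) : q z = q z' <-> subshift_set Z (zip_config (set_val z) (set_val z')).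
  by rewrite -eZ; split=> /eqmodP.
have qshift s : quotient_shift (q (y s)) = q (y (subshift_map s)).
  rewrite /q (quotient_shiftE eZ); congr (\pi_({eq_quot e}) _)%qT; apply: val_inj.
  by rewrite /= fS.
pose N := \max_(w <- F) size w.
have key s s' : (forall i : nat, (i < N)%N -> set_val s (Posz i) = set_val s' (Posz i)) ->
    q (y s) = q (y s').
  move=> ss'; apply/qE.
  apply: (@same_window_related A B S f Z F N) => //.
  - by move=> x; exact/(qE (y x) (y x)).
  - by move=> x x' /(qE (y x) (y x')) E; exact/(qE (y x') (y x)).
  - move=> x x' x'' /(qE (y x) (y x')) E /(qE (y x') (y x'')) E'.
    by apply/(qE (y x) (y x'')); rewrite E.
  - move=> x; have [p p0 pT] := finite_orbit_periodic (can_inj TK) (fin (g (q (y x)))).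
    exists p => //.
    have iterE n : h (iter n T (g (q (y x)))) = q (y (subshiftz (Posz n) x)).
      elim: n => [|n IH].
        rewrite /= gK; congr (q (y _)); apply: val_inj; exact/esym/shiftz0.
      rewrite iterS hT IH qshift; congr (q (y _)); apply: val_inj => /=.
      by rewrite !set_valE /= intS -shiftzD.
    rewrite -equivariantz //; apply/(qE (y x) (y _)).
    by rewrite -iterE pT gK.
  - by move=> x; rewrite SF.
  - by move=> w wF; exact: leq_bigmax_seq.
(* A point of [X] is determined by the window of any point of [S] above it. *)
apply: (@finite_of_fin_invariant X {ffun 'I_N -> B}
  (fun x c => exists2 s, h x = q (y s) & forall i : 'I_N, c i = set_val s (Posz (nat_of_ord i)))).
  move=> x.
  have [s sx] : exists s, f s = set_val (repr (h x)).
    have : range f (set_val (repr (h x))) by rewrite fY; exact: set_valP.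
    by move=> [s _ <-]; exists s.
  exists [ffun i : 'I_N => set_val s (Posz (nat_of_ord i))], s.
    rewrite -[LHS]reprK; congr (\pi_({eq_quot e}) _)%qT; exact: val_inj.
  by move=> i; rewrite ffunE.
move=> x x' c [s xs sc] [s' xs' s'c]; apply: (can_inj hK); rewrite xs xs'.
by apply: key => i iN; have := s'c (Ordinal iN); rewrite sc.
Qed.
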